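(* Let $n$ be an even positive integer, $m=\frac{n}{2}$, and let $\alpha_1,\alpha_2,\dots,\alpha_m$ be pairwise different real numbers with $\alpha_i\ge 1$ for $i=1,\dots,m$. Define the monic polynomials of degree $n$ $$a^0(s)=\prod_{j=1}^{m}(s^2+\alpha_j s+\alpha_j),$$ and, for $k=1,\dots,m$, $$a^{2k-1}(s)=(s^2+\alpha_k)\prod_{\substack{1\le j\le m\\ j\ne k}}(s^2+\alpha_j s+\alpha_j),\qquad a^{2k}(s)=(s^2+\alpha_k s)\prod_{\substack{1\le j\le m\\ j\ne k}}(s^2+\alpha_j s+\alpha_j).$$ Let $a^0,a^1,\dots,a^n\in\mathbb{R}^n$ be the corresponding coefficient vectors and let $$\mathcal{P}=\mathrm{conv}\{a^0,a^1,\dots,a^n\}\subset\mathbb{R}^n .$$ Then the interior of $\mathcal{P}$ is contained in $\mathcal{H}^n$; that is, every interior point of the polytope $\mathcal{P}$ is stable.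
   Context: A monic real polynomial $a(s)=a_1+a_2s+\dots+a_ns^{n-1}+s^n$ of degree $n$ is identified with its coefficient vector $a=(a_1,a_2,\dots,a_n)^T\in\mathbb{R}^n$ (the leading coefficient $1$ is omitted). The polynomial $a(s)$ is called (Hurwitz) stable if all of its complex roots $s_1,\dots,s_n$ satisfy $\mathrm{Re}(s_i)<0$; the corresponding vector is then called stable. The set of stable vectors is $$\mathcal{H}^n=\{a=(a_1,\dots,a_n)^T\in\mathbb{R}^n:\ a(s)\text{ is Hurwitz stable}\}.$$ $\mathrm{conv}$ denotes the convex hull, and the interior is taken in $\mathbb{R}^n$. *)

(* Defs.v *)
From HB Require Import structures.
From mathcomp Require Import all_boot all_order all_algebra.
From mathcomp Require Import complex.
From mathcomp Require Import boolp classical_sets reals topology normedtype.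
From mathcomp Require Import convex.

Set Implicit Arguments.
Unset Strict Implicit.
Unset Printing Implicit Defensive.

Import Order.TTheory GRing.Theory Num.Theory.
Import numFieldNormedType.Exports.

Local Open Scope classical_set_scope.
Local Open Scope ring_scope.

(* The entry of index i : 'I_n (counted from 0) of a vector is the coefficient
   of 'X^i; the leading coefficient 1 of a monic polynomial of degree n is not
   stored. *)
Definition monic_of_vec (R : realType) (n : nat) (a : 'cV[R]_n) : {poly R} :=
  \sum_(i < n) a i 0 *: 'X^i + 'X^n.

Definition vec_of_monic (R : realType) (n : nat) (p : {poly R}) : 'cV[R]_n :=
  \col_(i < n) p`_i.

Lemma vec_of_monicK (R : realType) (n : nat) (p : {poly R}) :
  p \is monic -> size p = n.+1 -> monic_of_vec (vec_of_monic n p) = p.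
Proof.
move=> /monicP p_monic sz_p; rewrite /monic_of_vec.
have lc1 : p`_n = 1 by rewrite -p_monic lead_coefE sz_p.
rewrite -[RHS]coefK sz_p poly_def big_ord_recr /= lc1 scale1r.
by congr (_ + _); apply: eq_bigr => i _; rewrite mxE.
Qed.

Lemma monic_of_vecK (R : realType) (n : nat) (a : 'cV[R]_n) :
  vec_of_monic n (monic_of_vec a) = a.
Proof.
apply/colP => i; rewrite mxE coefD coefXn (ltn_eqF (ltn_ord i)) addr0.
rewrite coef_sum (bigD1 i) //= coefZ coefXn eqxx mulr1 big1 ?addr0 // => j.
by rewrite eq_sym coefZ coefXn -val_eqE /= => /negPf->; rewrite mulr0.
Qed.

Definition hurwitz_stable (R : realType) (p : {poly R}) : Prop :=
  forall z : R[i], root (map_poly (real_complex R) p) z -> complex.Re z < 0.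

Definition stable_vecs (R : realType) (n : nat) : set 'cV[R]_n :=
  [set a | hurwitz_stable (monic_of_vec a)].

Definition conv_hull (R : realType) (n : nat) (A : set 'cV[R]_n) :
    set 'cV[R]_n :=
  smallest (@convex_set R 'cV[R]_n) A.

(* In the next definitions the index k : 'I_m counts from 0, so that
   [poly_odd alpha k] and [poly_even alpha k] are the polynomials a^{2k+1} and
   a^{2k+2}. *)
Definition quad_factor (R : realType) (c : R) : {poly R} :=
  'X^2 + c *: 'X + c%:P.

Definition poly_zero (R : realType) (m : nat) (alpha : 'I_m -> R) : {poly R} :=
  \prod_(j < m) quad_factor (alpha j).

Definition poly_odd (R : realType) (m : nat) (alpha : 'I_m -> R) (k : 'I_m) :
    {poly R} :=
  ('X^2 + (alpha k)%:P) * \prod_(j < m | j != k) quad_factor (alpha j).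

Definition poly_even (R : realType) (m : nat) (alpha : 'I_m -> R) (k : 'I_m) :
    {poly R} :=
  ('X^2 + alpha k *: 'X) * \prod_(j < m | j != k) quad_factor (alpha j).

Definition polytope (R : realType) (n m : nat) (alpha : 'I_m -> R) :
    set 'cV[R]_n :=
  conv_hull ([set vec_of_monic n (poly_zero alpha)]
    `|` range (fun k : 'I_m => vec_of_monic n (poly_odd alpha k))
    `|` range (fun k : 'I_m => vec_of_monic n (poly_even alpha k))).

Arguments polytope {R} n {m} alpha.

(* Main.v *)
(* For Re z >= 0 the quotient a^i(z) / a^0(z) of each vertex has nonnegative
   real part: only one quadratic factor survives, and (z^2 + c) / (z^2 + cz + c)
   and (z^2 + cz) / (z^2 + cz + c) have nonnegative real part there (the latter
   because c >= 1).  This inequality passes to the convex hull.  An interior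
   point x remains in the hull when moved slightly away from a^0, and since a^0
   itself has quotient 1, the quotient at x has positive real part; in
   particular x does not vanish at z. *)

Require Import Defs.
From HB Require Import structures.
From mathcomp Require Import all_boot all_order all_algebra.
From mathcomp Require Import complex.
From mathcomp Require Import boolp classical_sets reals topology normedtype.
From mathcomp Require Import convex interval_inference ring lra.

Set Implicit Arguments.
Unset Strict Implicit.
Unset Printing Implicit Defensive.

Import Order.TTheory GRing.Theory Num.Theory.
Import numFieldNormedType.Exports.

Local Open Scope classical_set_scope.
Local Open Scope ring_scope.

(** * Sign estimates for a single quadratic factor *)

Section ComplexDot.
Variable R : realType.
Implicit Types u v w : R[i].

(* The real part of [u * v^*]; it has the sign of the real part of [u / v]. *)
Definition cdot u v : R :=
  complex.Re u * complex.Re v + complex.Im u * complex.Im v.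

(** A common factor [w] only contributes [|w|^2], so the quadratic factors that a vertex shares with
    [a^0] do not affect the sign. *)
Lemma cdotMr u v w : cdot (u * w) (v * w) = cdot u v * cdot w w.
Proof. by case: u v w => [a b] [c d] [e f]; rewrite /cdot /=; ring. Qed.

Lemma cdot_ge0 u : 0 <= cdot u u.
Proof. by rewrite /cdot -!expr2 addr_ge0 ?sqr_ge0. Qed.

Lemma cdot_gt0 u : u != 0 -> 0 < cdot u u.
Proof.
move=> u0; rewrite lt_neqAle cdot_ge0 andbT eq_sym; move: u0.
by rewrite /cdot -!expr2 paddr_eq0 ?sqr_ge0// !sqrf_eq0 eq_complex.
Qed.

Lemma cdot_affine (s t : R) u v w :
  cdot (real_complex R s * u + real_complex R t * v) w
    = s * cdot u w + t * cdot v w.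
Proof. by case: u v w => [a b] [c d] [e f]; rewrite /cdot /=; ring. Qed.

Lemma cdot_odd_quad (c : R) (z : R[i]) : 0 <= c -> 0 <= complex.Re z ->
  0 <= cdot (z ^+ 2 + real_complex R c)
            (z ^+ 2 + real_complex R c * z + real_complex R c).
Proof.
case: z => x y /= c0 x0; rewrite /cdot /=.
(* This is [|z^2 + c|^2 + c * Re z * (|z|^2 + c)]. *)
rewrite [leRHS](_ : _ = (x ^+ 2 - y ^+ 2 + c) ^+ 2 + (x * y *+ 2) ^+ 2
    + c * x * (x ^+ 2 + y ^+ 2 + c)); last by ring.
by rewrite !(addr_ge0, sqr_ge0, mulr_ge0).
Qed.

Lemma cdot_even_quad (c : R) (z : R[i]) : 1 <= c -> 0 <= complex.Re z ->
  0 <= cdot (z ^+ 2 + real_complex R c * z)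
            (z ^+ 2 + real_complex R c * z + real_complex R c).
Proof.
case: z => x y /= c1 x0; rewrite /cdot /=.
(* Expand [|z^2 + c z|^2 + c * Re (z^2 + c z)]: the negative term [- c y^2] is absorbed by
   [c^2 y^2], which is where [1 <= c] enters. *)
rewrite [leRHS](_ : _ =
    (x ^+ 2 + y ^+ 2) * (x * (x + c *+ 2) + y ^+ 2) + (c ^+ 2 + c) * x ^+ 2
    + c ^+ 2 * x + c * (c - 1) * y ^+ 2); last by ring.
have c0 : 0 <= c by exact: le_trans c1.
move: c1; rewrite -subr_ge0; move: (c - 1) => d d0.
by rewrite !(addr_ge0, sqr_ge0, mulr_ge0, mulrn_wge0).
Qed.

Lemma quad_neq0 (c : R) (z : R[i]) : 0 < c -> 0 <= complex.Re z ->
  z ^+ 2 + real_complex R c * z + real_complex R c != 0.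
Proof.
case: z => x y /= c0 x0; rewrite eq_complex /=; apply/negP => /andP[/eqP re /eqP im].
(* The imaginary part is [y (2 x + c)] with [2 x + c > 0], so a root would be real; but then
   [x^2 + c x + c > 0]. *)
have [y0|yN0] := eqVneq y 0.
  by move: re; rewrite y0; nra.
have : y * (x *+ 2 + c) = 0 by rewrite -[RHS]im; ring.
by move/eqP; rewrite mulf_eq0 (negPf yN0)/= => /eqP; lra.
Qed.

End ComplexDot.

(** * Coefficient vectors, monicity and degree *)

(** The weights must sum to 1 to preserve the implicit leading term. They may be negative, which
    serves for moving beyond [x] away from [a^0]. *)
Lemma monic_of_vec_affine (R : realType) (n : nat) (s t : R) (a b : 'cV[R]_n) :
  s + t = 1 -> monic_of_vec (s *: a + t *: b)
             = s *: monic_of_vec a + t *: monic_of_vec b.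
Proof.
move=> st1; rewrite /monic_of_vec !scalerDr addrACA -scalerDl st1 scale1r.
congr (_ + _); rewrite !scaler_sumr -big_split /=; apply: eq_bigr => i _.
by rewrite !mxE scalerDl !scalerA.
Qed.

Lemma monic_prod_size3 (R : realType) (m : nat) (g : 'I_m -> {poly R}) :
  (forall j, g j \is monic /\ size (g j) = 3) ->
  \prod_(j < m) g j \is monic /\ size (\prod_(j < m) g j) = (m.*2).+1.
Proof.
move=> g3; split; first by apply: monic_prod => j _; case: (g3 j).
rewrite size_prod; last by move=> j _; rewrite monic_neq0; case: (g3 j).
rewrite (eq_bigr (fun=> 3)); last by move=> j _; case: (g3 j).
(* The size is one plus the sum of the sizes, minus the number of factors: [3 m + 1 - m]. *)
by rewrite sum_nat_const card_ord (mulnS m 2) muln2 -addnS addKn.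
Qed.

Lemma quadratic_monic_size (R : realType) (b c : R) :
  'X^2 + (b *: 'X + c%:P) \is monic /\ size ('X^2 + (b *: 'X + c%:P)) = 3.
Proof.
have sz : (size (b *: 'X + c%:P)%R < size ('X^2 : {poly R}))%N.
  by rewrite size_polyXn -mul_polyC size_MXaddC; case: ifP => // _;
    rewrite ltnS (leq_ltn_trans (size_polyC_leq1 _)).
by rewrite monicE lead_coefDl// size_polyDl// lead_coefXn size_polyXn.
Qed.

(** A single product over all indices has the shape that [monic_prod_size3] expects. *)
Lemma poly_oddE (R : realType) (m : nat) (alpha : 'I_m -> R) (k : 'I_m) :
  poly_odd alpha k = \prod_(j < m)
    if j == k then 'X^2 + (alpha k)%:P else quad_factor (alpha j).
Proof.
rewrite (bigD1 k)//= eqxx; congr (_ * _).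
by apply: eq_bigr => j /negPf ->.
Qed.

Lemma poly_evenE (R : realType) (m : nat) (alpha : 'I_m -> R) (k : 'I_m) :
  poly_even alpha k = \prod_(j < m)
    if j == k then 'X^2 + alpha k *: 'X else quad_factor (alpha j).
Proof.
rewrite (bigD1 k)//= eqxx; congr (_ * _).
by apply: eq_bigr => j /negPf ->.
Qed.

(** * The vertices and the inequality on their convex hull *)

Section Vertices.
Variables (R : realType) (m : nat) (alpha : 'I_m -> R).

Lemma quad_factor_monic_size (c : R) :
  quad_factor c \is monic /\ size (quad_factor c) = 3.
Proof. by rewrite /quad_factor -addrA; exact: quadratic_monic_size. Qed.

Lemma poly_zero_monic_size :
  poly_zero alpha \is monic /\ size (poly_zero alpha) = (m.*2).+1.
Proof. by apply: monic_prod_size3 => j; exact: quad_factor_monic_size. Qed.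

Lemma poly_odd_monic_size (k : 'I_m) :
  poly_odd alpha k \is monic /\ size (poly_odd alpha k) = (m.*2).+1.
Proof.
rewrite poly_oddE; apply: monic_prod_size3 => j.
case: ifP => _; last exact: quad_factor_monic_size.
by have := quadratic_monic_size 0 (alpha k); rewrite scale0r add0r.
Qed.

Lemma poly_even_monic_size (k : 'I_m) :
  poly_even alpha k \is monic /\ size (poly_even alpha k) = (m.*2).+1.
Proof.
rewrite poly_evenE; apply: monic_prod_size3 => j.
case: ifP => _; last exact: quad_factor_monic_size.
by have := quadratic_monic_size (alpha k) 0; rewrite addr0.
Qed.

Definition evalC (p : {poly R}) (z : R[i]) : R[i] :=
  (map_poly (real_complex R) p).[z].

Lemma evalCM p q z : evalC (p * q) z = evalC p z * evalC q z.
Proof. by rewrite /evalC rmorphM hornerM. Qed.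

Lemma evalC_affine (s t : R) p q z : evalC (s *: p + t *: q) z
  = real_complex R s * evalC p z + real_complex R t * evalC q z.
Proof. by rewrite /evalC rmorphD /= !map_polyZ hornerD !hornerZ. Qed.

Lemma evalC_quad_factor c z : evalC (quad_factor c) z
  = z ^+ 2 + real_complex R c * z + real_complex R c.
Proof.
by rewrite /evalC /quad_factor !rmorphD /= map_polyZ map_polyXn map_polyX
  map_polyC !hornerE.
Qed.

Hypothesis alpha_ge1 : forall i : 'I_m, 1 <= alpha i.

Lemma evalC_poly_zero_neq0 z : 0 <= complex.Re z ->
  evalC (poly_zero alpha) z != 0.
Proof.
move=> z0; rewrite /evalC /poly_zero rmorph_prod horner_prod.
apply/prodf_neq0 => j _; rewrite -/(evalC _ _) evalC_quad_factor quad_neq0//.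
exact: lt_le_trans (alpha_ge1 j).
Qed.

Lemma poly_zeroE (k : 'I_m) : poly_zero alpha
  = quad_factor (alpha k) * \prod_(j < m | j != k) quad_factor (alpha j).
Proof. by rewrite /poly_zero (bigD1 k). Qed.

Lemma cdot_poly_odd k z : 0 <= complex.Re z ->
  0 <= cdot (evalC (poly_odd alpha k) z) (evalC (poly_zero alpha) z).
Proof.
move=> z0; rewrite (poly_zeroE k) /poly_odd !evalCM cdotMr.
apply: mulr_ge0 (cdot_ge0 _); rewrite evalC_quad_factor.
rewrite /evalC rmorphD /= map_polyXn map_polyC !hornerE.
by apply: cdot_odd_quad => //; apply: le_trans (alpha_ge1 k).
Qed.

Lemma cdot_poly_even k z : 0 <= complex.Re z ->
  0 <= cdot (evalC (poly_even alpha k) z) (evalC (poly_zero alpha) z).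
Proof.
move=> z0; rewrite (poly_zeroE k) /poly_even !evalCM cdotMr.
apply: mulr_ge0 (cdot_ge0 _); rewrite evalC_quad_factor.
rewrite /evalC rmorphD /= map_polyZ map_polyXn map_polyX !hornerE.
exact: cdot_even_quad.
Qed.

Lemma polytope_cdot_ge0 n (a : 'cV[R]_n) z : n = m.*2 -> polytope n alpha a ->
  0 <= complex.Re z ->
  0 <= cdot (evalC (monic_of_vec a) z) (evalC (poly_zero alpha) z).
Proof.
move=> nE Pa z0.
(* For fixed [z] the inequality is affine in [b], so [C] is a half-space or trivial, hence convex;
   it remains to check the vertices. *)
pose C := [set b : 'cV[R]_n |
  0 <= cdot (evalC (monic_of_vec b) z) (evalC (poly_zero alpha) z)].
suff /(_ _ Pa) : polytope n alpha `<=` C by [].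
have vK p : p \is monic /\ size p = (m.*2).+1 ->
    monic_of_vec (vec_of_monic n p) = p.
  by rewrite -nE => -[pm ps]; exact: vec_of_monicK.
apply: smallest_sub.
  move=> u v t /set_mem Cu /set_mem Cv; apply/mem_set; rewrite /C /=.
  rewrite [conv t u v](_ : _ = t%:num *: (u : 'cV[R]_n)
    + (1 - t%:num) *: (v : 'cV[R]_n))//.
  rewrite monic_of_vec_affine ?subrKC// evalC_affine cdot_affine.
  by rewrite addr_ge0// mulr_ge0// subr_ge0.
move=> _ [[->|[k _ <-]]|[k _ <-]]; rewrite /C /= vK.
- exact: cdot_ge0.
- exact: poly_zero_monic_size.
- exact: cdot_poly_odd.
- exact: poly_odd_monic_size.
- exact: cdot_poly_even.
- exact: poly_even_monic_size.
Qed.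

End Vertices.

(** * Interior points and stability *)

Lemma interior_extend (R : realType) (n : nat) (A : set 'cV[R]_n)
    (x a : 'cV[R]_n) : interior A x ->
  exists2 t : R, 0 < t & A ((1 + t) *: x + (- t) *: a).
Proof.
move=> /nbhs_ballP[e /= e0 xA].
pose S := \sum_(i < n) `|x i 0 - a i 0|.
have S0 : 0 <= S by exact: sumr_ge0.
have S1 : 0 < 1 + S by rewrite ltr_pwDl.
(* The displacement is [t (x - a)], whose entries are at most [t S < e] in absolute value; the added
   1 keeps the denominator positive when [x = a]. *)
exists (e / (1 + S)); first exact: divr_gt0.
apply: xA; split=> // i j; rewrite ord1 !mxE /ball /=.
rewrite [X in `|X|](_ : _ = - (e / (1 + S) * (x i 0 - a i 0))); last by ring.
rewrite normrN normrM gtr0_norm ?divr_gt0// mulrAC ltr_pdivrMr// ltr_pM2l//.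
rewrite ltr_pwDl// /S (bigD1 i)//= lerDl; exact: sumr_ge0.
Qed.

Theorem theorem1 (R : realType) (n m : nat) (alpha : 'I_m -> R)
    (n_gt0 : (0 < n)%N) (n_even : ~~ odd n) (mE : m = n./2)
    (alpha_inj : injective alpha) (alpha_ge1 : forall i : 'I_m, 1 <= alpha i) :
  interior (polytope n alpha) `<=` @stable_vecs R n.
Proof.
have nE : n = m.*2 by rewrite mE even_halfK.
move=> x /(interior_extend (vec_of_monic n (poly_zero alpha)))[t t0 Pb] z xz.
rewrite ltNge; apply/negP => z0.
have := polytope_cdot_ge0 alpha_ge1 nE Pb z0.
have [mon sz] := poly_zero_monic_size alpha.
rewrite monic_of_vec_affine ?addrK// vec_of_monicK//; last by rewrite nE.
(* Since [x] vanishes at [z], the extended point takes the value [- t a^0(z)] there, which gives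
   [- t |a^0(z)|^2 < 0], a contradiction. *)
rewrite evalC_affine cdot_affine /evalC (rootP xz) -/(evalC _ _).
rewrite {1}/cdot !mul0r addr0 mulr0 add0r mulNr oppr_ge0 leNgt.
by rewrite mulr_gt0// cdot_gt0// evalC_poly_zero_neq0.
Qed.
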